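(* The system (S) defined in the context has the following invariant divisors: for each $i\in\{0,1,\dots,6\}$, if $\alpha_i=0$, then $f_i$ defines an invariant divisor of (S), where $$f_0=q_1-t,\quad f_1=q_1-\eta,\quad f_2=p_1,\quad f_3=q_1-q_2,\quad f_4=p_2,\quad f_5=q_2-1,\quad f_6=q_2.$$
   Context: **The system (S).** Let $\eta\in\mathbb{C}\setminus\{0,1\}$ and let $\alpha_0,\dots,\alpha_6\in\mathbb{C}$ satisfy $\alpha_0+\alpha_1+2(\alpha_2+\alpha_3+\alpha_4)+\alpha_5+\alpha_6=1$. For $\beta_0+\beta_1+2\beta_2+\beta_3+\beta_4=1$ define $H_{VI}(q,p,\eta,t;\beta_0,\dots,\beta_4)$ by $$t(t-1)(t-\eta)H_{VI}=q(q-1)(q-\eta)(q-t)p^2+\{\beta_1(t-\eta)q(q-1)+2\beta_2q(q-1)(q-\eta)+\beta_3(t-1)q(q-\eta)+\beta_4t(q-1)(q-\eta)\}p+\beta_2\{(\beta_1+\beta_2)(t-\eta)+\beta_2(q-1)+\beta_3(t-1)+t\beta_4\}q.$$ The system (S) is the Hamiltonian system $\frac{dq_i}{dt}=\frac{\partial H}{\partial p_i}$, $\frac{dp_i}{dt}=-\frac{\partial H}{\partial q_i}$ $(i=1,2)$ with $$H=H_{VI}(q_1,p_1,\eta,t;\alpha_0,\alpha_1,\alpha_2,\alpha_3+2\alpha_4+\alpha_5,\alpha_3+\alpha_6)+H_{VI}(q_2,p_2,\eta,t;\alpha_0+2\alpha_2+\alpha_3,\alpha_1+\alpha_3,\alpha_4,\alpha_5,\alpha_6)+\frac{2(q_1-\eta)q_2\{(q_1-t)p_1+\alpha_2\}\{(q_2-1)p_2+\alpha_4\}}{t(t-1)(t-\eta)}.$$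 **Invariant divisor.** A polynomial $f\in\mathbb{C}(t)[q_1,p_1,q_2,p_2]$ defines an invariant divisor of (S) if its derivative along the flow, $\frac{\partial f}{\partial t}+\sum_{i=1}^2\left(\frac{\partial H}{\partial p_i}\frac{\partial f}{\partial q_i}-\frac{\partial H}{\partial q_i}\frac{\partial f}{\partial p_i}\right)$, is divisible by $f$ in $\mathbb{C}(t)[q_1,p_1,q_2,p_2]$. *)

(* Defs.v *)
From HB Require Import structures.
From mathcomp Require Import all_boot all_order all_algebra.
From mathcomp Require Import generic_quotient.
From mathcomp Require Import ring.
From mathcomp Require Export complex reals mpoly.

Set Implicit Arguments.
Unset Strict Implicit.
Unset Printing Implicit Defensive.

Import GRing.Theory.
Local Open Scope ring_scope.
Local Open Scope quotient_scope.

Notation ratfun C := {fraction {poly C}}.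
Notation phase_poly C := {mpoly (ratfun C)[4]}.

Local Notation "x %:F" := (tofrac x).

Section Derivation.

Variable C : fieldType.

(* Quotient rule applied to the representative chosen by [repr]; [ddtE] shows
   that the choice of the representative is irrelevant. *)
Definition ddt (x : ratfun C) : ratfun C :=
  let r := repr x in
  ((\n_r)^`() * \d_r - \n_r * (\d_r)^`())%:F / (\d_r ^+ 2)%:F.

Lemma ddtE (a b : {poly C}) : b != 0 ->
  ddt (a%:F / b%:F) = (a^`() * b - a * b^`())%:F / (b ^+ 2)%:F.
Proof.
move=> b0; rewrite /ddt; set x := a%:F / b%:F; set r := repr x.
have d0 : \d_r != 0 by exact: denom_ratioP.
have xE : x = (\n_r)%:F / (\d_r)%:F.
  have -> : x = \pi_(ratfun C) (Ratio \n_r \d_r).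
    by rewrite Ratio_numden reprK.
  rewrite /tofrac; unlock.
  rewrite -[_^-1]/(FracField.inv _) -[_ * _]/(FracField.mul _ _).
  rewrite -FracField.pi_inv -FracField.pi_mul /=.
  apply/eqmodP; rewrite /= FracField.equivfE /FracField.mulf /FracField.invf.
  by rewrite !numden_Ratio ?mulf_neq0 ?oner_neq0 ?mulr1 ?mul1r // mulrC.
have F0 (p : {poly C}) : p != 0 -> p%:F != 0 by rewrite tofrac_eq0.
have e : a * \d_r = \n_r * b.
  apply/eqP; rewrite -tofrac_eq !tofracM -eqr_div ?F0 //.
  by rewrite -xE.
have de : a^`() * \d_r + a * (\d_r)^`() = (\n_r)^`() * b + \n_r * b^`().
  by rewrite -!derivM e.
apply/eqP; rewrite eqr_div ?F0 ?expf_neq0 // -!tofracM tofrac_eq; apply/eqP.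
have E1 : (\n_r)^`() * b = a^`() * \d_r + a * (\d_r)^`() - \n_r * b^`().
  by rewrite de addrK.
transitivity (((\n_r)^`() * b) * b * \d_r - (\n_r * b) * b * (\d_r)^`()).
  by ring.
rewrite E1 -e.
transitivity (a^`() * b * \d_r ^+ 2 + a * \d_r * b * (\d_r)^`()
  - (\n_r * b) * b^`() * \d_r - a * \d_r * b * (\d_r)^`()); first by ring.
by rewrite -e; ring.
Qed.

End Derivation.

Section System.

Variable C : fieldType.
Implicit Types (eta : C) (alpha : 'I_7 -> C) (f H : phase_poly C).

Definition q1 : phase_poly C := 'X_(inord 0).
Definition p1 : phase_poly C := 'X_(inord 1).
Definition q2 : phase_poly C := 'X_(inord 2).
Definition p2 : phase_poly C := 'X_(inord 3).

Definition tF : ratfun C := 'X%:F.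
Definition cstF (c : C) : ratfun C := c%:P%:F.

Definition tP : phase_poly C := tF%:MP.
Definition cst (c : C) : phase_poly C := (cstF c)%:MP.

(* b0 does not occur in the formula: it is determined by
   b0 + b1 + 2 b2 + b3 + b4 = 1. *)
Definition HVI (q p : phase_poly C) (eta b0 b1 b2 b3 b4 : C) : phase_poly C :=
  (tF * (tF - 1) * (tF - cstF eta))^-1 *:
  (q * (q - 1) * (q - cst eta) * (q - tP) * p ^+ 2
   + (cst b1 * (tP - cst eta) * q * (q - 1)
      + 2 * cst b2 * q * (q - 1) * (q - cst eta)
      + cst b3 * (tP - 1) * q * (q - cst eta)
      + cst b4 * tP * (q - 1) * (q - cst eta)) * p
   + cst b2 * ((cst b1 + cst b2) * (tP - cst eta) + cst b2 * (q - 1)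
               + cst b3 * (tP - 1) + tP * cst b4) * q).

Definition hamiltonian eta alpha : phase_poly C :=
  let a_ (k : nat) := alpha (inord k) in
  HVI q1 p1 eta (a_ 0%N) (a_ 1%N) (a_ 2%N)
      (a_ 3%N + 2 * a_ 4%N + a_ 5%N) (a_ 3%N + a_ 6%N)
  + HVI q2 p2 eta (a_ 0%N + 2 * a_ 2%N + a_ 3%N) (a_ 1%N + a_ 3%N)
      (a_ 4%N) (a_ 5%N) (a_ 6%N)
  + (tF * (tF - 1) * (tF - cstF eta))^-1 *:
    (2 * (q1 - cst eta) * q2
     * ((q1 - tP) * p1 + cst (a_ 2%N)) * ((q2 - 1) * p2 + cst (a_ 4%N))).

Definition flow_derivative H f : phase_poly C :=
  map_mpoly (@ddt C) f
  + (H^`M(inord 1) * f^`M(inord 0) - H^`M(inord 0) * f^`M(inord 1))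
  + (H^`M(inord 3) * f^`M(inord 2) - H^`M(inord 2) * f^`M(inord 3)).

Definition invariant_divisor H f : Prop :=
  exists g : phase_poly C, flow_derivative H f = g * f.

Definition divisor_poly eta (i : 'I_7) : phase_poly C :=
  nth 0 [:: q1 - tP; q1 - cst eta; p1; q1 - q2; p2; q2 - 1; q2] i.

End System.

(* Main.v *)
Require Import Defs.
From HB Require Import structures.
From mathcomp Require Import all_boot all_order all_algebra.
From mathcomp Require Import generic_quotient ring.

(** Along the flow, q_i moves with velocity dH/dp_i and p_i with velocity
    -dH/dq_i, while t moves with velocity 1; so the claim for f_i is that the
    velocity of f_i vanishes on f_i = 0 as soon as alpha_i = 0.

    For f_2 = p_1 and f_4 = p_2 the parameter multiplies every monomial of H
    that involves q_j but not p_j.  Hence, when it vanishes, H is the sum of a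
    multiple of p_j and of a polynomial that is free of q_j, and dH/dq_j is
    again a multiple of p_j ([invariant_p1], [invariant_p2]).

    For f_1, f_5 and f_6 every term of the velocity [velocity] of H_VI, and of
    the coupling between the two copies of H_VI, has the factor f_i except
    the one that carries alpha_i.  For f_3 = q_1 - q_2 the momenta and the
    parameters cancel between the two velocities once q_1 = q_2, because
    alpha_3 = 0.

    The divisor of f_0 = q_1 - t moves, and this is where the normalization of
    the parameters enters: at q_1 = t the velocity of q_1 is
    beta_1 + 2 beta_2 + beta_3 + beta_4 = 1 - alpha_0, where the beta_k are the
    parameters of the first H_VI, and this equals dt/dt = 1 when alpha_0 = 0.

    For these five divisors the quotient is written out, so that the claim is a
    polynomial identity once the velocities are known ([flow_q1E], [flow_q2E]).
    All this holds in every commutative ring with the right partial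
    derivatives ([invariant_divisors]); the analysis of the rational functions
    of t is only needed to see that applying d/dt to the coefficients is additive
    and sends t to 1 ([ddt_is_zmod_morphism], [ddt_poly]). *)

Set Implicit Arguments.
Unset Strict Implicit.
Unset Printing Implicit Defensive.

Import GRing.Theory.
Local Open Scope ring_scope.

Local Notation "x %:F" := (tofrac x).

(** * The system over a differential ring *)

(** The computation only uses the partial derivatives of the generators.  The
    ring [A] of functions on the phase space is kept abstract because [ring] is
    impracticably slow in polynomials over a field of fractions, where its
    reification has to compare large algebraic structures. *)

Section DifferentialRing.

Variables (K A : comNzRingType) (cst : {rmorphism K -> A}).

Definition K_derivation (d : {additive A -> A}) :=
  (forall x y, d (x * y) = d x * y + x * d y) /\ (forall c, d (cst c) = 0).

Lemma K_derivation1 d : K_derivation d -> d 1 = 0.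
Proof. by case=> _ d_cst; rewrite -(rmorph1 cst). Qed.

(** [D] is the common factor 1 / (t (t - 1) (t - eta)) of the Hamiltonian. *)
Variables (eta : K) (t D : A).

Definition quartic q := q * (q - 1) * (q - cst eta) * (q - t).

Definition momentum_coef q b1 b2 b3 b4 :=
  cst b1 * (t - cst eta) * q * (q - 1)
  + 2 * cst b2 * q * (q - 1) * (q - cst eta)
  + cst b3 * (t - 1) * q * (q - cst eta)
  + cst b4 * t * (q - 1) * (q - cst eta).

Definition HVI_numerator q p b1 b2 b3 b4 :=
  quartic q * p ^+ 2 + momentum_coef q b1 b2 b3 b4 * p
  + cst b2 * ((cst b1 + cst b2) * (t - cst eta) + cst b2 * (q - 1)
              + cst b3 * (t - 1) + t * cst b4) * q.

(** The partial derivative of [HVI_numerator] with respect to p. *)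
Definition velocity q p b1 b2 b3 b4 :=
  2 * quartic q * p + momentum_coef q b1 b2 b3 b4.

(** With beta_2 = 0 the line p = 0 is invariant for a single H_VI. *)
Lemma HVI_beta2_0 q p b1 b3 b4 :
  HVI_numerator q p b1 0 b3 b4 = (quartic q * p + momentum_coef q b1 0 b3 b4) * p.
Proof. by rewrite /HVI_numerator; ring. Qed.

(** Specialized to the three partial derivatives that kill q, this covers both
    dq/dt and the independence of each H_VI from the other pair of variables. *)
Lemma derivation_HVI d q p b1 b2 b3 b4 :
  K_derivation d -> d t = 0 -> d q = 0 ->
  d (HVI_numerator q p b1 b2 b3 b4) = velocity q p b1 b2 b3 b4 * d p.
Proof.
move=> der dt dq; have d1 := K_derivation1 der; have [dM d_cst] := der.
have d2 : d 2 = 0 by rewrite raddfMn d1 mul0rn.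
rewrite /HVI_numerator /velocity /quartic /momentum_coef expr2.
rewrite !(raddfD, raddfN, dM, d_cst, dt, dq, d1, d2) /=; ring.
Qed.

(** [x] lists q1, p1, q2, p2 in this order, and [d i] is the partial derivative
    with respect to [x i]. *)
Variables (x : 'I_4 -> A) (d : 'I_4 -> {additive A -> A}) (dt : {additive A -> A}).
Hypotheses (D_inv : D * (t * (t - 1) * (t - cst eta)) = 1)
  (d_der : forall i, K_derivation (d i))
  (d_t : forall i, d i t = 0) (d_D : forall i, d i D = 0)
  (d_x : forall i j, d i (x j) = (i == j)%:R)
  (dt_cst : forall c, dt (cst c) = 0) (dt_t : dt t = 1)
  (dt_x : forall i, dt (x i) = 0).

Local Notation q1 := (x (inord 0)).
Local Notation p1 := (x (inord 1)).
Local Notation q2 := (x (inord 2)).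
Local Notation p2 := (x (inord 3)).

Definition flow h f :=
  dt f + (d (inord 1) h * d (inord 0) f - d (inord 0) h * d (inord 1) f)
  + (d (inord 3) h * d (inord 2) f - d (inord 2) h * d (inord 3) f).

Definition invariant h f := exists g, flow h f = g * f.

Lemma inord4_eq (i j : nat) : (i < 4)%N -> (j < 4)%N ->
  (inord i == inord j :> 'I_4) = (i == j).
Proof. by move=> i4 j4; rewrite -val_eqE /= !inordK. Qed.

Lemma d_coord (i j : nat) : (i < 4)%N -> (j < 4)%N ->
  d (inord i) (x (inord j)) = (i == j)%:R.
Proof. by move=> i4 j4; rewrite d_x inord4_eq. Qed.

Lemma dM i y z : d i (y * z) = d i y * z + y * d i z.
Proof. by have [] := d_der i. Qed.

Lemma d_cst i c : d i (cst c) = 0.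
Proof. by have [] := d_der i. Qed.

Lemma d_1 i : d i 1 = 0.
Proof. exact: K_derivation1. Qed.

Lemma d_2 i : d i 2 = 0.
Proof. by rewrite raddfMn d_1 mul0rn. Qed.

Lemma flowB h f g : flow h (f - g) = flow h f - flow h g.
Proof. by rewrite /flow !raddfB; ring. Qed.

Lemma flow_cst h c : flow h (cst c) = 0.
Proof. by rewrite /flow dt_cst !d_cst; ring. Qed.

Lemma flow_t h : flow h t = 1.
Proof. by rewrite /flow dt_t !d_t; ring. Qed.

Lemma flow_q1 h : flow h q1 = d (inord 1) h.
Proof. by rewrite /flow dt_x !d_coord //=; ring. Qed.

Lemma flow_p1 h : flow h p1 = - d (inord 0) h.
Proof. by rewrite /flow dt_x !d_coord //=; ring. Qed.

Lemma flow_q2 h : flow h q2 = d (inord 3) h.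
Proof. by rewrite /flow dt_x !d_coord //=; ring. Qed.

Lemma flow_p2 h : flow h p2 = - d (inord 2) h.
Proof. by rewrite /flow dt_x !d_coord //=; ring. Qed.

Lemma derivation_prefactor i y : d i (D * y) = D * d i y.
Proof. by rewrite dM d_D mul0r add0r. Qed.

Variable alpha : 'I_7 -> K.
Local Notation a k := (alpha (inord k)).

Definition HVI1 :=
  HVI_numerator q1 p1 (a 1) (a 2) (a 3 + 2 * a 4 + a 5) (a 3 + a 6).

Definition HVI2 := HVI_numerator q2 p2 (a 1 + a 3) (a 4) (a 5) (a 6).

Definition coupling :=
  2 * (q1 - cst eta) * q2
  * ((q1 - t) * p1 + cst (a 2)) * ((q2 - 1) * p2 + cst (a 4)).

Definition coupled_hamiltonian := D * HVI1 + D * HVI2 + D * coupling.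
Local Notation H := coupled_hamiltonian.

Lemma flow_q1E : flow H q1 = D *
  (velocity q1 p1 (a 1) (a 2) (a 3 + 2 * a 4 + a 5) (a 3 + a 6)
   + 2 * (q1 - cst eta) * q2 * (q1 - t) * ((q2 - 1) * p2 + cst (a 4))).
Proof.
rewrite flow_q1 !raddfD /= !derivation_prefactor -!mulrDr; congr (_ * _).
rewrite /HVI1 /HVI2 !derivation_HVI ?d_coord //= /coupling.
rewrite !(raddfD, raddfN, dM, d_cst, d_t, d_1, d_2) /=.
by rewrite !d_coord //=; ring.
Qed.

Lemma flow_q2E : flow H q2 = D *
  (velocity q2 p2 (a 1 + a 3) (a 4) (a 5) (a 6)
   + 2 * (q1 - cst eta) * q2 * (q2 - 1) * ((q1 - t) * p1 + cst (a 2))).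
Proof.
rewrite flow_q2 !raddfD /= !derivation_prefactor -!mulrDr; congr (_ * _).
rewrite /HVI1 /HVI2 !derivation_HVI ?d_coord //= /coupling.
rewrite !(raddfD, raddfN, dM, d_cst, d_t, d_1, d_2) /=.
by rewrite !d_coord //=; ring.
Qed.

(** * Cofactors *)

(** The cofactor collects the difference quotients between q1 and t of the
    cubics that multiply the parameters in [momentum_coef]. *)
Lemma invariant_q1_t :
  a 0 + a 1 + 2 * (a 2 + a 3 + a 4) + a 5 + a 6 = 1 ->
  a 0 = 0 -> invariant H (q1 - t).
Proof.
move=> sum_a a0.
have sum_cst : cst (a 1) + 2 * cst (a 2) + (cst (a 3) + 2 * cst (a 4) + cst (a 5))
    + (cst (a 3) + cst (a 6)) = 1.
  by rewrite -[RHS](rmorph1 cst) -[in RHS]sum_a a0; ring.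
exists (D * (2 * q1 * (q1 - 1) * (q1 - cst eta) * p1
  + 2 * (q1 - cst eta) * q2 * ((q2 - 1) * p2 + cst (a 4))
  + cst (a 1) * (t - cst eta) * (q1 + t - 1)
  + 2 * cst (a 2)
    * (q1 ^+ 2 + q1 * t + t ^+ 2 - (1 + cst eta) * (q1 + t) + cst eta)
  + (cst (a 3) + 2 * cst (a 4) + cst (a 5)) * (t - 1) * (q1 + t - cst eta)
  + (cst (a 3) + cst (a 6)) * t * (q1 + t - 1 - cst eta))).
rewrite flowB flow_t flow_q1E.
(* Writing dt/dt = 1 as D t (t - 1) (t - eta) times the sum of the parameters
   makes the identity homogeneous in the parameters, hence polynomial. *)
rewrite -[X in _ - X](mulr1 1) -[X in _ - X * _]D_inv -[X in _ - _ * X]sum_cst.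
by rewrite /velocity /quartic /momentum_coef; ring.
Qed.

Lemma invariant_q1_eta : a 1 = 0 -> invariant H (q1 - cst eta).
Proof.
move=> a1.
exists (D * (2 * q1 * (q1 - 1) * (q1 - t) * p1
  + 2 * q2 * (q1 - t) * ((q2 - 1) * p2 + cst (a 4))
  + 2 * cst (a 2) * q1 * (q1 - 1)
  + cst (a 3 + 2 * a 4 + a 5) * (t - 1) * q1
  + cst (a 3 + a 6) * t * (q1 - 1))).
rewrite flowB flow_cst flow_q1E a1.
by rewrite /velocity /quartic /momentum_coef; ring.
Qed.

(** Terms of H with q1 but without p1 all carry alpha_2; hence H is [K1 * p1] plus
    a part free of q1, and the flow derivative - dH/dq1 of p1 is a multiple of p1. *)
Lemma invariant_p1 : a 2 = 0 -> invariant H p1.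
Proof.
move=> a2.
pose K1 := D * (quartic q1 * p1
    + momentum_coef q1 (a 1) 0 (a 3 + 2 * a 4 + a 5) (a 3 + a 6)
  + 2 * (q1 - cst eta) * q2 * (q1 - t) * ((q2 - 1) * p2 + cst (a 4))).
have -> : H = K1 * p1 + D * HVI2.
  by rewrite /coupled_hamiltonian /HVI1 a2 HVI_beta2_0 /coupling a2 /K1; ring.
exists (- d (inord 0) K1); rewrite flow_p1 raddfD /= derivation_prefactor dM.
by rewrite /HVI2 derivation_HVI ?d_coord //=; ring.
Qed.

(** The p1-terms of the two velocities differ by q1 (q1 - 1) - q2 (q2 - 1), and
    the p2-terms by (q1 - eta) (q1 - t) - (q2 - eta) (q2 - t), up to common
    factors; the coupling is what produces the mixed products.  The cofactor
    lists these difference quotients, and those of the parameter terms. *)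
Lemma invariant_q1_q2 : a 3 = 0 -> invariant H (q1 - q2).
Proof.
move=> a3.
exists (D * (2 * (q1 - cst eta) * (q1 - t) * (q1 + q2 - 1) * p1
  + 2 * q2 * (q2 - 1) * (q1 + q2 - cst eta - t) * p2
  + cst (a 1) * (t - cst eta) * (q1 + q2 - 1)
  + 2 * cst (a 2) * (q1 - cst eta) * (q1 + q2 - 1)
  + 2 * cst (a 4)
    * ((t - 1) * (q1 - cst eta) + q2 * (q1 + q2 - 1 - cst eta))
  + cst (a 5) * (t - 1) * (q1 + q2 - cst eta)
  + cst (a 6) * t * (q1 + q2 - 1 - cst eta))).
by rewrite flowB flow_q1E flow_q2E a3 /velocity /quartic /momentum_coef; ring.
Qed.

Lemma invariant_p2 : a 4 = 0 -> invariant H p2.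
Proof.
move=> a4.
pose K2 := D * (quartic q2 * p2 + momentum_coef q2 (a 1 + a 3) 0 (a 5) (a 6)
  + 2 * (q1 - cst eta) * q2 * ((q1 - t) * p1 + cst (a 2)) * (q2 - 1)).
have -> : H = K2 * p2 + D * HVI1.
  by rewrite /coupled_hamiltonian /HVI2 a4 HVI_beta2_0 /coupling a4 /K2; ring.
exists (- d (inord 2) K2); rewrite flow_p2 raddfD /= derivation_prefactor dM.
by rewrite /HVI1 derivation_HVI ?d_coord //=; ring.
Qed.

Lemma invariant_q2_1 : a 5 = 0 -> invariant H (q2 - 1).
Proof.
move=> a5.
exists (D * (2 * q2 * (q2 - cst eta) * (q2 - t) * p2
  + 2 * (q1 - cst eta) * q2 * ((q1 - t) * p1 + cst (a 2))
  + cst (a 1 + a 3) * (t - cst eta) * q2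
  + 2 * cst (a 4) * q2 * (q2 - cst eta)
  + cst (a 6) * t * (q2 - cst eta))).
rewrite flowB -(rmorph1 cst) flow_cst rmorph1 flow_q2E a5.
by rewrite /velocity /quartic /momentum_coef; ring.
Qed.

Lemma invariant_q2 : a 6 = 0 -> invariant H q2.
Proof.
move=> a6.
exists (D * (2 * (q2 - 1) * (q2 - cst eta) * (q2 - t) * p2
  + 2 * (q1 - cst eta) * (q2 - 1) * ((q1 - t) * p1 + cst (a 2))
  + cst (a 1 + a 3) * (t - cst eta) * (q2 - 1)
  + 2 * cst (a 4) * (q2 - 1) * (q2 - cst eta)
  + cst (a 5) * (t - 1) * (q2 - cst eta))).
by rewrite flow_q2E a6 /velocity /quartic /momentum_coef; ring.
Qed.

Lemma invariant_divisors :
  a 0 + a 1 + 2 * (a 2 + a 3 + a 4) + a 5 + a 6 = 1 ->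
  forall i : 'I_7, alpha i = 0 ->
  invariant H (nth 0 [:: q1 - t; q1 - cst eta; p1; q1 - q2; p2; q2 - 1; q2] i).
Proof.
move=> sum_a i; rewrite -{1}(inord_val i); case: i => k /= ltk7.
do 7?[case: k ltk7 => [|k] ltk7 /=]; last by [].
- exact: invariant_q1_t.
- exact: invariant_q1_eta.
- exact: invariant_p1.
- exact: invariant_q1_q2.
- exact: invariant_p2.
- exact: invariant_q2_1.
- exact: invariant_q2.
Qed.

End DifferentialRing.

(** * Derivation in t *)

Section Derivation.

Variable C : fieldType.

Lemma ratfun_fraction (x : ratfun C) :
  exists a b : {poly C}, b != 0 /\ x = a%:F / b%:F.
Proof.
exists (\n_(repr x)), (\d_(repr x)); split; first exact: denom_ratioP.
rewrite -[LHS]reprK -[in LHS](Ratio_numden (repr x)) /tofrac; unlock.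
rewrite -[_^-1]/(FracField.inv _) -[_ * _]/(FracField.mul _ _).
rewrite -FracField.pi_inv -FracField.pi_mul /=.
apply/eqmodP; rewrite /= FracField.equivfE /FracField.mulf /FracField.invf.
by rewrite !numden_Ratio ?mulf_neq0 ?oner_neq0 ?denom_ratioP ?mulr1 ?mul1r // mulrC.
Qed.

Lemma subf_div (F : fieldType) (u v w z : F) : v != 0 -> z != 0 ->
  u / v - w / z = (u * z - w * v) / (v * z).
Proof. by move=> v0 z0; rewrite -mulNr addf_div // mulNr. Qed.

(** Additivity on coefficients is what lets [map_mpoly] commute with sums. *)
Lemma ddt_is_zmod_morphism : zmod_morphism (@ddt C).
Proof.
move=> x y; have [a [b [b0 ->]]] := ratfun_fraction x.
have [c [d [d0 ->]]] := ratfun_fraction y.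
have F0 (p : {poly C}) : p != 0 -> p%:F != 0 by rewrite tofrac_eq0.
have -> : a%:F / b%:F - c%:F / d%:F = (a * d - c * b)%:F / (b * d)%:F.
  by rewrite tofracB !tofracM -subf_div ?F0.
rewrite !ddtE ?mulf_neq0 // subf_div ?F0 ?expf_neq0 //.
apply/eqP; rewrite -!tofracM -tofracB eqr_div ?F0 ?mulf_neq0 ?expf_neq0 //.
rewrite -!tofracM tofrac_eq derivB !derivM; apply/eqP; ring.
Qed.

HB.instance Definition _ := GRing.isZmodMorphism.Build (ratfun C) (ratfun C)
  (@ddt C) ddt_is_zmod_morphism.

Lemma ddt_poly (p : {poly C}) : ddt p%:F = (p^`())%:F.
Proof.
have -> : p%:F = p%:F / 1%:F by rewrite tofrac1 divr1.
by rewrite ddtE ?oner_neq0 // derivC mulr1 mulr0 subr0 expr1n tofrac1 divr1.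
Qed.

End Derivation.

Lemma mderiv_var (n : nat) (R : nzRingType) (i j : 'I_n) :
  ('X_j : {mpoly R[n]})^`M(i) = (i == j)%:R.
Proof.
rewrite mderivX mnm1E eq_sym; case: eqP => [->|_]; last by rewrite scale0r.
rewrite scale1r (_ : (U_(j) - U_(j))%MM = 0%MM) ?mpolyX0 //.
by apply/mnmP => k; rewrite mnmBE subnn mnm0E.
Qed.

(** * The phase space as a differential ring *)

Section PhaseSpace.

Variable C : fieldType.

HB.instance Definition _ := GRing.RMorphism.copy (@cst C)
  (@mpolyC 4 (ratfun C) \o @tofrac {poly C} \o polyC).

Lemma mderiv_K_derivation (i : 'I_4) : K_derivation (@cst C) (mderiv i).
Proof. by split=> [f g|c]; [exact: mderivM | exact: mderivC]. Qed.

Lemma map_ddt_cst (c : C) : map_mpoly (@ddt C) (cst c) = 0.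
Proof. by rewrite map_mpolyC /= ddt_poly derivC tofrac0 mpolyC0. Qed.

Lemma map_ddt_tP : map_mpoly (@ddt C) (tP C) = 1.
Proof. by rewrite map_mpolyC /= ddt_poly derivX tofrac1 mpolyC1. Qed.

Lemma map_ddt_var (i : 'I_4) : map_mpoly (@ddt C) 'X_i = 0.
Proof.
rewrite /map_mpoly /mmap msuppX big_seq1 mcoeffX eqxx /=.
by rewrite -tofrac1 ddt_poly derivC tofrac0 mpolyC0 mul0r.
Qed.

Definition prefactor (eta : C) : phase_poly C :=
  ((tF C * (tF C - 1) * (tF C - cstF eta))^-1)%:MP.

Lemma prefactorK (eta : C) :
  prefactor eta * (tP C * (tP C - 1) * (tP C - cst eta)) = 1.
Proof.
have -> : tP C * (tP C - 1) * (tP C - cst eta)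
    = (tF C * (tF C - 1) * (tF C - cstF eta))%:MP.
  by rewrite !mpolyCM !mpolyCB mpolyC1.
rewrite -mpolyCM mulVf // !mulf_neq0 ?tofrac_eq0 ?polyX_eq0 //.
  by rewrite -tofrac1 -tofracB tofrac_eq0 -polyC1 polyXsubC_eq0.
by rewrite -tofracB tofrac_eq0 polyXsubC_eq0.
Qed.

Lemma hamiltonian_coupledE (eta : C) (alpha : 'I_7 -> C) :
  hamiltonian eta alpha =
  coupled_hamiltonian (@cst C) eta (tP C) (prefactor eta) (fun i => 'X_i) alpha.
Proof. by rewrite /hamiltonian /HVI -!mul_mpolyC. Qed.

Lemma phase_space_invariant_divisors (eta : C) (alpha : 'I_7 -> C) :
  alpha (inord 0) + alpha (inord 1)
  + 2 * (alpha (inord 2) + alpha (inord 3) + alpha (inord 4))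
  + alpha (inord 5) + alpha (inord 6) = 1 ->
  forall i : 'I_7, alpha i = 0 ->
    invariant_divisor (hamiltonian eta alpha) (divisor_poly eta i).
Proof.
rewrite hamiltonian_coupledE.
exact: (@invariant_divisors _ _ (@cst C) eta (tP C) (prefactor eta)
  (fun i => 'X_i) (fun i => mderiv i) (map_mpoly (@ddt C))
  (prefactorK eta) mderiv_K_derivation (fun i => mderivC i _)
  (fun i => mderivC i _) (@mderiv_var _ _) map_ddt_cst map_ddt_tP map_ddt_var).
Qed.

End PhaseSpace.

Theorem proposition2p1 (R : realType) (eta : R[i]) (alpha : 'I_7 -> R[i])
    (heta0 : eta <> 0) (heta1 : eta <> 1)
    (halpha : alpha (inord 0) + alpha (inord 1)
      + 2 * (alpha (inord 2) + alpha (inord 3) + alpha (inord 4))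
      + alpha (inord 5) + alpha (inord 6) = 1) :
  forall i : 'I_7, alpha i = 0 ->
    invariant_divisor (hamiltonian eta alpha) (divisor_poly eta i).
Proof. exact: phase_space_invariant_divisors. Qed.
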